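(* Let $(\mathcal X,d)$ be a (not necessarily compact) metric space and $F\subset C(\mathcal X,\mathcal X)$. Assume: (1) (uniform contraction) $\sup_{f\in F}\mathrm{Lip}(f)\le c<1$; (2) (compact attractor) there exists a nonempty compact $F$-invariant set $A\subset\mathcal X$, i.e. $f(A)\subset A$ for all $f\in F$; (3) (absorbing set) there exist $L\in\mathbb N$ and a bounded set $K\subset\mathcal X$ such that $f(\mathcal X)\subset K$ for every depth-$L$ map $f\in F^L$. Then for every $\varepsilon>0$ there exists $$m(\varepsilon):=L+\Big\lceil\log_{1/c}\Big(\tfrac{2\,\mathrm{diam}(K)}{\varepsilon}\Big)\Big\rceil$$ such that for all $k\ge m(\varepsilon)$, $$N\big(B(k,F),d_\infty,\varepsilon\big)\le N\big(A,d,\tfrac{\varepsilon}{2}\big)+\sum_{\ell=0}^{m(\varepsilon)-1}N\big(F^\ell,d_\infty,\varepsilon\big).$$ In particular, the right-hand side is independent of $k$, so growth in $k$ saturates at any fixed $\varepsilon$ to the entropy of the attractor $A$.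
   Context: $C(\mathcal X,\mathcal X)$ is the set of continuous self-maps of $\mathcal X$, with the uniform metric $d_\infty(f,g)=\sup_{x\in\mathcal X}d(f(x),g(x))$, which may be infinite for some pairs when $\mathcal X$ is non-compact. $\mathrm{Lip}(f)=\sup_{x\ne y}d(f(x),f(y))/d(x,y)$. $F^\ell$ is the set of compositions of exactly $\ell$ maps from $F$ (with $F^0=\{\mathrm{id}\}$), and $B(k,F)=\bigcup_{0\le\ell\le k}F^\ell$ is the set of compositions of at most $k$ maps from $F$. For a subset $E$ of a metric space $(\mathcal M,\rho)$, $N(E,\rho,\varepsilon)$ is the covering number: the least cardinality of a set $C\subset\mathcal M$ such that the $\rho$-balls of radius $\varepsilon$ centered at the points of $C$ cover $E$ (here $\mathcal M=\mathcal X$ or $\mathcal M=C(\mathcal X,\mathcal X)$). $\mathrm{diam}(K)$ is the diameter of $K$ in $d$. The value $L=0$ is allowed (for compact $\mathcal X$ one may take $A=K=\mathcal X$ and $L=0$).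
   Formalization: The ceiling in m(ε) is replaced by 0 when it is negative or diam(K)=0 (the claim fails otherwise, e.g. X=ℝ, F={0}, L=1, K=[0,ε/8], c=1/2), and c>0 is assumed so that log base 1/c is defined. *)

(* Defs.v *)
From HB Require Import structures.
From mathcomp Require Import all_boot all_order all_algebra.
From mathcomp Require Import all_classical all_reals all_analysis.

Set Implicit Arguments.
Unset Strict Implicit.
Unset Printing Implicit Defensive.

Import Order.TTheory GRing.Theory Num.Theory.

Local Open Scope classical_set_scope.
Local Open Scope ring_scope.

(* [rho] is extended-real valued, since the uniform metric below may be
   infinite.  Balls are open, as for [ball] in a [metricType]; the centres
   range over the whole ambient type [M], not only over [E]. *)
Definition is_cover (R : realType) (M : Type) (rho : M -> M -> \bar R)
    (E : set M) (eps : R) (C : set M) : Prop :=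
  E `<=` [set y | exists2 x, C x & (rho x y < eps%:E)%E].

(* [counting C] is the number of elements of [C], and +oo if [C] is infinite;
   the infimum is attained, and is +oo exactly when there is no finite cover. *)
Definition covering_number (R : realType) (M : choiceType)
    (E : set M) (rho : M -> M -> \bar R) (eps : R) : \bar R :=
  ereal_inf [set counting C | C in [set C | is_cover rho E eps C]].

Section MetricNotions.
Context {R : realType} {X : metricType R}.

Definition ext_mdist (x y : X) : \bar R := (mdist x y)%:E.

Definition metric_bounded (K : set X) : Prop :=
  exists r : R, forall x y, K x -> K y -> mdist x y <= r.

(* Meaningful for bounded [K]; [diam set0 = 0]. *)
Definition diam (K : set X) : R := sup [set mdist x y | x in K & y in K].

Definition dinfty (f g : continuousType X X) : \bar R :=
  ereal_sup [set ext_mdist (f x) (g x) | x in [set: X]].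

(* The [maxe 0%:E] only matters when [X] has at most one point: the supremum is
   taken in [0, +oo]. *)
Definition Lip (f : continuousType X X) : \bar R :=
  maxe 0%:E (ereal_sup [set (mdist (f p.1) (f p.2) / mdist p.1 p.2)%:E
                      | p in [set p : X * X | p.1 != p.2]]).

Fixpoint depth (l : nat) (F : set (continuousType X X)) :
    set (continuousType X X) :=
  match l with
  | 0 => [set (idfun : continuousType X X)]
  | l'.+1 => [set (f \o g : continuousType X X) | f in F & g in depth l' F]
  end.

Definition depth_upto (k : nat) (F : set (continuousType X X)) :
    set (continuousType X X) :=
  \bigcup_(l in [set l | (l <= k)%N]) depth l F.

End MetricNotions.

(* Logarithm of [x] in base [b]; note that [ln 0 = 0] by convention. *)
Definition logb (R : realType) (b x : R) : R := ln x / ln b.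

(* L + ceil (log_{1/c} (2 D / eps)), where a negative ceiling (2 D much smaller
   than eps, in particular D = 0) is read as 0, so that the depth is a natural
   number not smaller than L. *)
Definition saturation_depth (R : realType) (L : nat) (c D eps : R) : nat :=
  (L + absz (Num.max 0 (Num.ceil (logb c^-1 (2 * D / eps))))%R)%N.

(* Main.v *)
(** A map of depth at least [m = L + n] is a map of depth [n] after one with
    values in [K], so its image has diameter at most
    [c ^+ n * diam K <= eps / 2].  That image meets [A], hence the map is
    [eps]-close to a constant map whose value is a centre of an [eps / 2]-cover
    of [A].  The lower depths are covered one at a time. *)

Require Import Defs.
From HB Require Import structures.
From mathcomp Require Import all_boot all_order all_algebra.
From mathcomp Require Import all_classical all_reals all_analysis.
From mathcomp Require Import finmap.

Set Implicit Arguments.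
Unset Strict Implicit.
Unset Printing Implicit Defensive.

Import Order.TTheory GRing.Theory Num.Theory.

Local Open Scope classical_set_scope.
Local Open Scope ring_scope.

Section CoveringNumber.
Context {R : realType}.

Lemma counting_fset (T : choiceType) (s : {fset T}) :
  counting [set` s] = (#|` s|%:R)%:E :> \bar R.
Proof. by rewrite /counting asboolT ?set_fsetK//; exact: finite_fset. Qed.

Context {M : choiceType} (rho : M -> M -> \bar R) (eps : R).

Lemma covering_number_le_card (E : set M) (s : {fset M}) :
  is_cover rho E eps [set` s] ->
  (covering_number E rho eps <= (#|` s|%:R)%:E)%E.
Proof.
by move=> Es; rewrite -counting_fset; apply: ereal_inf_lbound; exists [set` s].
Qed.

(** Sizes of finite covers are natural numbers, so a least one exists as soon as there is a finite
    cover; infinite covers all count [+oo]. Later bounds thus only handle finite sets of centres. *)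
Lemma covering_number_attained (E : set M) :
  covering_number E rho eps = +oo%E \/
  exists2 s : {fset M}, is_cover rho E eps [set` s] &
    covering_number E rho eps = (#|` s|%:R)%:E.
Proof.
pose P n := `[< exists2 s : {fset M}, is_cover rho E eps [set` s] & #|` s| = n >].
have [[n Pn]|noP] := pselect (exists n, P n); last first.
  left; apply/eqP; rewrite -leye_eq; apply: le_ereal_inf_tmp => _ [C EC <-].
  rewrite /counting; case: asboolP => // /finite_fsetP[s Cs].
  by case: noP; exists #|` s|; apply/asboolP; exists s => //; rewrite -Cs.
right; case: (ex_minnP (ex_intro P n Pn)) => k /asboolP[s Es <-] smin.
exists s => //; apply/eqP; rewrite eq_le covering_number_le_card//=.
apply: le_ereal_inf_tmp => _ [C EC <-].
rewrite /counting; case: asboolP => [/finite_fsetP[t Ct]|]; last by rewrite leey.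
rewrite Ct set_fsetK lee_fin ler_nat; apply: smin; apply/asboolP.
by exists t => //; rewrite -Ct.
Qed.

Lemma covering_number_ge0 (E : set M) : (0 <= covering_number E rho eps)%E.
Proof.
by case: (covering_number_attained E) => [->//|[s _ ->]]; rewrite lee_fin.
Qed.

Lemma covering_number0 : covering_number set0 rho eps = 0%E.
Proof.
apply/eqP; rewrite eq_le covering_number_ge0 andbT.
by rewrite (le_trans (@covering_number_le_card set0 fset0 _)) ?cardfs0.
Qed.

Lemma le_covering_number (E1 E2 : set M) : E1 `<=` E2 ->
  (covering_number E1 rho eps <= covering_number E2 rho eps)%E.
Proof.
move=> E12; apply: ereal_inf_le_tmp => _ [C EC <-].
by exists C => //; apply: subset_trans EC.
Qed.

Lemma covering_numberU (E1 E2 : set M) :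
  (covering_number (E1 `|` E2) rho eps <=
   covering_number E1 rho eps + covering_number E2 rho eps)%E.
Proof.
have [->|[s E1s ->]] := covering_number_attained E1.
  (* The sum is [+oo] because the other summand is nonnegative, hence not [-oo]. *)
  by rewrite addye ?leey// gt_eqF// (lt_le_trans _ (covering_number_ge0 _)).
have [->|[t E2t ->]] := covering_number_attained E2; first by rewrite addey// leey.
apply: (@le_trans _ _ (#|` s `|` t|%:R)%:E)%fset.
  apply: covering_number_le_card => y [/E1s|/E2t] [x xst xy];
    by exists x => //=; rewrite in_fsetU xst ?orbT.
by rewrite -EFinD -natrD lee_fin ler_nat cardfsU leq_subr.
Qed.

Lemma covering_number_bigcup (E : nat -> set M) (n : nat) :
  (covering_number (\bigcup_(i in [set i | (i < n)%N]) E i) rho eps <=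
   \sum_(0 <= i < n) covering_number (E i) rho eps)%E.
Proof.
elim: n => [|n IHn].
  rewrite big_geq// (_ : \bigcup_(i in _) _ = set0) ?covering_number0//.
  by rewrite -subset0 => x [].
rewrite big_nat_recr//=; apply: le_trans (leeD2r _ IHn).
apply: le_trans (covering_numberU _ _); apply: le_covering_number => x [i /= ].
rewrite ltnS leq_eqVlt => /predU1P[->|ltin]; first by right.
by left; exists i.
Qed.

End CoveringNumber.

(** Pushing the centres of a finite cover of [E] forward along [phi] gives a cover of [E'] with no
    more centres. As centres may lie outside [E], the hypothesis must speak of every [x] in [M]. *)
Lemma covering_number_image (R : realType) (M N : choiceType)
    (rho : M -> M -> \bar R) (sigma : N -> N -> \bar R) (phi : M -> N)
    (E : set M) (E' : set N) (eps eps' : R) :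
  (forall y, E' y -> exists2 a, E a &
     forall x, (rho x a < eps%:E)%E -> (sigma (phi x) y < eps'%:E)%E) ->
  (covering_number E' sigma eps' <= covering_number E rho eps)%E.
Proof.
move=> Ephi; have [->|[s Es ->]] := covering_number_attained rho eps E.
  exact: leey.
apply: (@le_trans _ _ (#|` [fset phi x | x in s]%fset|%:R)%:E).
  apply: covering_number_le_card => y /Ephi[a /Es[x xs xa] /(_ x xa) xy].
  by exists (phi x) => //=; apply: in_imfset.
by rewrite lee_fin ler_nat leq_imfset_card.
Qed.

Section UniformContraction.
Context {R : realType} {X : metricType R}.
Implicit Types (F : set (continuousType X X)) (f g h : continuousType X X).

Lemma mdist_le_Lip f (c : R) (x y : X) :
  (Lip f <= c%:E)%E -> mdist (f x) (f y) <= c * mdist x y.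
Proof.
have [->|xy] := eqVneq x y; first by rewrite !mdistxx mulr0.
rewrite -ler_pdivrMr ?mdist_gt0// -lee_fin; apply: le_trans.
by rewrite le_max; apply/orP; right; apply: ereal_sup_ubound; exists (x, y).
Qed.

Lemma mdist_le_depth F (c : R) (n : nat) f (x y : X) : 0 <= c ->
  (ereal_sup [set Lip g | g in F] <= c%:E)%E -> depth n F f ->
  mdist (f x) (f y) <= c ^+ n * mdist x y.
Proof.
move=> c0 Fc; elim: n f => [f ->|n IHn _ [g Fg [h Fh <-]]]; first by rewrite mul1r.
rewrite exprS -mulrA (@le_trans _ _ (c * mdist (h x) (h y)))//.
  by apply: (@mdist_le_Lip g); apply: le_trans Fc; apply: ereal_sup_ubound; exists g.
by rewrite ler_wpM2l// IHn.
Qed.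

Lemma depth_stable F (A : set X) (n : nat) f (x : X) :
  (forall g, F g -> g @` A `<=` A) -> depth n F f -> A x -> A (f x).
Proof.
move=> FA; elim: n f => [f ->//|n IHn _ [g Fg [h Fh <-]]] Ax.
by apply: (FA g Fg); exists (h x) => //; exact: IHn.
Qed.

(** Reassociating the composition changes the packaged continuity proof; pointwise equality avoids
    comparing such proofs. *)
Lemma depthD F (a b : nat) f : depth (a + b) F f ->
  exists2 g, depth a F g & exists2 h, depth b F h & f =1 g \o h.
Proof.
elim: a f => [f Ff|a IHa _ [u Fu [v Fv <-]]].
  by exists idfun => //; exists f.
have [g Fg [h Fh vgh]] := IHa _ Fv.
exists (u \o g : continuousType X X); first by exists u => //; exists g.
by exists h => // x /=; rewrite vgh.
Qed.

(** Boundedness makes the real [sup] in [diam] a genuine upper bound rather than a default value. *)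
Lemma mdist_le_diam (K : set X) (x y : X) :
  metric_bounded K -> K x -> K y -> mdist x y <= diam K.
Proof.
move=> [r Kr] Kx Ky; apply: ub_le_sup; last by exists x => //; exists y.
by exists r => _ [u Ku [v Kv <-]]; exact: Kr.
Qed.

Lemma mdist_le_deep F (c : R) (K : set X) (L n l : nat) f (x y : X) : 0 <= c ->
  (ereal_sup [set Lip g | g in F] <= c%:E)%E ->
  metric_bounded K -> (forall g, depth L F g -> range g `<=` K) ->
  (L + n <= l)%N -> depth l F f ->
  mdist (f x) (f y) <= c ^+ n * diam K.
Proof.
(* Write [l = n + (L + r)]: the inner [r] maps are arbitrary, the next [L] land in [K], and the
   outer [n] contract by [c ^+ n]. *)
move=> c0 Fc bK FK; rewrite addnC => /subnKC <-.
rewrite -addnA => /depthD[g Fg [h /depthD[u Fu [v _ huv]] fgh]].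
rewrite !fgh /=; apply: le_trans (mdist_le_depth _ _ c0 Fc Fg) _.
rewrite ler_wpM2l ?exprn_ge0//; apply: mdist_le_diam => //.
- by apply: (FK u Fu); rewrite huv; exists (v x).
- by apply: (FK u Fu); rewrite huv; exists (v y).
Qed.

(** The triangle inequality through [f a0] gives a bound uniform in [y], so the strict inequality
    survives the supremum, as open balls require. *)
Lemma dinfty_cst_lt f (x a0 : X) (d e : R) :
  (forall y, mdist (f a0) (f y) <= d) -> mdist x (f a0) + d < e ->
  (dinfty (cst x) f < e%:E)%E.
Proof.
move=> fd; rewrite -lte_fin; apply: le_lt_trans.
apply: ge_ereal_sup => _ [y _ <-]; rewrite lee_fin.
by rewrite (le_trans (metric_triangle _ (f a0) _))// lerD2l.
Qed.

End UniformContraction.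

Lemma saturation_depthP (R : realType) (L : nat) (c D eps : R) :
  0 < c -> c < 1 -> 0 < eps ->
  exists2 n, saturation_depth L c D eps = (L + n)%N & c ^+ n * D <= eps / 2.
Proof.
move=> c0 c1 e0; exists (absz (Num.max 0 (Num.ceil (logb c^-1 (2 * D / eps))))) => //.
(* For [D <= 0] the left-hand side is nonpositive whatever [n] is; this keeps the logarithm away
   from its default values. *)
set n := absz _; have [D0|D0] := leP D 0.
  by rewrite (@le_trans _ _ 0) ?divr_ge0 ?(ltW e0)// mulr_ge0_le0 ?exprn_ge0 ?(ltW c0).
have lnc : 0 < ln c^-1 by rewrite ln_gt0// invf_gt1.
(* Clipping the ceiling at 0 can only increase it, so [n] still bounds the logarithm. *)
have : logb c^-1 (2 * D / eps) <= n%:R.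
  rewrite (le_trans (ceil_ge _))// -[n%:R]/(n%:~R) ler_int gez0_abs.
    by rewrite le_max lexx orbT.
  by rewrite le_max lexx.
rewrite /logb ler_pdivrMr// [_ * ln _]mulr_natl -lnXn ?invr_gt0//.
rewrite ler_ln ?posrE ?divr_gt0 ?mulr_gt0 ?exprn_gt0 ?invr_gt0//.
rewrite ler_pdivrMr// exprVn ler_pdivlMl ?exprn_gt0// => cD.
by rewrite ler_pdivlMr// -mulrA [D * 2]mulrC.
Qed.

Theorem mainTheorem5 (R : realType) (X : metricType R)
    (F : set (continuousType X X)) (c : R) (A K : set X) (L : nat) :
  0 < c -> c < 1 ->
  (ereal_sup [set Lip f | f in F] <= c%:E)%E ->
  A !=set0 -> compact A -> (forall f, F f -> f @` A `<=` A) ->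
  metric_bounded K -> (forall f, depth L F f -> range f `<=` K) ->
  forall eps : R, 0 < eps ->
  let m := saturation_depth L c (diam K) eps in
  forall k : nat, (m <= k)%N ->
  (covering_number (depth_upto k F) dinfty eps <=
     covering_number A ext_mdist (eps / 2)
     + \sum_(0 <= l < m) covering_number (depth l F) dinfty eps)%E.
Proof.
move=> c0 c1 Fc [a0 Aa0] _ FA bK FK eps e0 m k _.
have [n mE cD] := saturation_depthP L (diam K) c0 c1 e0.
(* All depths from [m] on are covered together, which makes the bound independent of [k]. *)
pose deep := \bigcup_(l in [set l | (m <= l)%N]) depth l F.
pose shallow := \bigcup_(l in [set l | (l < m)%N]) depth l F.
apply: (@le_trans _ _ (covering_number (deep `|` shallow) dinfty eps)).
  apply: le_covering_number => f [l _ Fl].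
  by have [ml|lm] := leqP m l; [left; exists l|right; exists l].
apply: le_trans (covering_numberU _ _ _ _) (leeD _ _); last first.
  exact: covering_number_bigcup.
(* The constant maps serve as centres: they are continuous, and centres need not belong to the
   covered set. *)
apply: (@covering_number_image _ _ _ _ _
  (fun x => cst x : continuousType X X)) => f [l /= ml Fl].
(* By invariance, the image of [f] meets [A] at [f a0]. *)
exists (f a0); first exact: depth_stable FA Fl Aa0.
move=> x; rewrite lte_fin => xa0.
apply: (@dinfty_cst_lt _ _ _ _ a0 (eps / 2)).
  move=> y; apply: le_trans cD.
  by apply: (mdist_le_deep _ _ (ltW c0) Fc bK FK _ Fl); rewrite -mE.
by rewrite [ltRHS]splitr ltrD2r.
Qed.
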